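(* Let $\delta>0$ and let $\{P_\theta:|\theta|<\delta,\ \theta\in\mathbb{R}\}$ be a statistical model that is Hellinger differentiable with Fisher information $\mathcal{I}(t)$ for $t\in(-\delta,\delta)$. Let $X=(X_1,\dots,X_n)$ consist of $n$ IID observations from $P_\theta$, and let $\psi(P_\theta)=\max(0,\theta)$. Then $$\inf_T\sup_{|\theta|<\delta}\mathbb{E}_\theta|T(X)-\psi(P_\theta)|^2\ \ge\ \sup_{a\in[0,1]}\frac{a^2}{4\pi^2\delta^{-2}w_a^{-2}+n\sup_{|t|<\delta}\mathcal{I}(t)},$$ where $w_a:=2/(y_a+1)$ and $y_a\in[0,1]$ is the solution of $\;y_a-\sin(-\pi y_a)/\pi=|2a-1|$. The infimum is over measurable real-valued functions $T$ of $X$.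
   Context: All $P_\theta$ have densities with respect to a common $\sigma$-finite measure $\nu$; $\mathbb{E}_\theta$ is expectation under $n$ IID observations from $P_\theta$. Hellinger differentiability at $t$: there is $\dot\xi_t\in L_2(\nu)$ with $\int[dP_{t+h}^{1/2}-dP_t^{1/2}-h\dot\xi_t]^2d\nu=o(h^2)$ as $h\to0$; $\mathcal{I}(t)=4\int\dot\xi_t^2\,d\nu$ is the Fisher information of one observation. The right-hand side is $0$ if $\sup_{|t|<\delta}\mathcal{I}(t)=\infty$. *)

(* Defs.v *)
From HB Require Import structures.
From mathcomp Require Import all_boot all_order all_algebra.
From mathcomp Require Import ring lra.
From mathcomp Require Import all_classical all_reals all_analysis.

Set Implicit Arguments.
Unset Strict Implicit.
Unset Printing Implicit Defensive.

Import Order.TTheory GRing.Theory Num.Theory.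
Import numFieldNormedType.Exports.

Local Open Scope classical_set_scope.
Local Open Scope ring_scope.

Section iid.
Context (d : measure_display) (T : measurableType d) (R : realType).

Definition tcons n (xs : T * n.-tuple T) : n.+1.-tuple T :=
  [tuple of xs.1 :: xs.2].

Lemma measurable_tcons n : measurable_fun [set: T * n.-tuple T] (@tcons n).
Proof. exact: measurable_cons. Qed.

HB.instance Definition _ n :=
  isMeasurableFun.Build _ _ _ _ (@tcons n) (@measurable_tcons n).

(* The joint law of n independent observations from P, i.e. the n-fold product
   measure, as the image of P \x P^n under (x, xs) |-> x :: xs.  It is
   characterized by iid_law_prod below. *)
Fixpoint iid_law (P : probability T R) (n : nat) :
    probability (n.-tuple T) R :=
  match n with
  | 0 => \d_([tuple] : 0.-tuple T)
  | m.+1 => distribution (P \x iid_law P m)%E (@tcons m)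
  end.

Lemma iid_law_prod (P : probability T R) n (A : 'I_n -> set T) :
  (forall i, measurable (A i)) ->
  iid_law P n [set x | forall i, A i (tnth x i)] = (\prod_(i < n) P (A i))%E.
Proof.
elim: n A => [|n IHn] A mA.
  rewrite big_ord0 /= diracE; apply/eqP; rewrite eqe pnatr_eq1 eqb1.
  by rewrite inE => -[].
rewrite big_ord_recl /= /distribution /pushforward.
rewrite (_ : _ @^-1` _ = A ord0 `*`
    [set x : n.-tuple T | forall i, A (lift ord0 i) (tnth x i)]); last first.
  apply/seteqP; split=> -[x xs] /=.
    move=> H; split; first exact: (H ord0).
    by move=> i; have := H (lift ord0 i); rewrite /tcons tnthS.
  move=> [Ax Axs] i; have [->//|i0] := eqVneq i ord0.
  have [j ->] : exists j, i = lift ord0 j.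
    by case: (unliftP ord0 i) i0 => [j ->|->]; [exists j|rewrite eqxx].
  by rewrite /tcons tnthS; exact: Axs.
rewrite product_measure1E//; first by congr (_ * _)%E; exact: IHn.
rewrite [X in measurable X](_ : _ = \bigcap_(i in [set: 'I_n])
  ((fun x : n.-tuple T => tnth x i) @^-1` A (lift ord0 i))).
  apply: fin_bigcap_measurable => // i _; rewrite -[_ @^-1` _]setTI.
  exact: measurable_tnth.
by apply/seteqP; split=> x /= H i; [move=> _|]; exact: H.
Qed.

End iid.

Section hellinger.
Context (d : measure_display) (T : measurableType d) (R : realType).
Variable nu : {measure set T -> \bar R}.

Definition is_density (p : T -> R) (P : probability T R) : Prop :=
  [/\ measurable_fun setT p,
      forall x, 0 <= p x &
      forall A, measurable A -> P A = (\int[nu]_(x in A) (p x)%:E)%E].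

(* The integral is the real-valued one, which is 0 by convention when its
   extended value is infinite.  This does not occur here: when p s is a density
   for all s near t and xi is in L2, it is finite for all h near 0. *)
Definition hellinger_derivative (p : R -> T -> R) (t : R) (xi : T -> R) : Prop :=
  xi \in Lfun nu 2%:E /\
  (fun h : R => \int[nu]_x
     (Num.sqrt (p (t + h) x) - Num.sqrt (p t x) - h * xi x) ^+ 2)
  =o_ (0 : R) (fun h : R => h ^+ 2).

Definition fisher_information (xi : T -> R) : \bar R :=
  (4%:E * \int[nu]_x (xi x ^+ 2)%:E)%E.

End hellinger.

Section minimax.
Context (d : measure_display) (T : measurableType d) (R : realType).

(* psi is given as a function of the parameter theta rather than of P theta, so
   that theta need not be identifiable from P theta. *)
Definition max_risk (delta : R) (P : R -> probability T R) (psi : R -> R)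
    (n : nat) (t : n.-tuple T -> R) : \bar R :=
  ereal_sup [set ('E_(iid_law (P theta) n)[fun x => (`|t x - psi theta| ^+ 2)%R])%E
            | theta in [set theta | `|theta| < delta]].

Definition minimax_risk (delta : R) (P : R -> probability T R) (psi : R -> R)
    (n : nat) : \bar R :=
  ereal_inf [set max_risk delta P psi t
            | t in [set t : n.-tuple T -> R | measurable_fun setT t]].

End minimax.

Section bound.
Context (R : realType).

Definition y_eq (a y : R) : Prop :=
  0 <= y <= 1 /\ y - sin (- pi * y) / pi = `|2 * a - 1|.

(* The solution exists and is unique for 0 <= a <= 1, see y_eqP. *)
Definition y_ (a : R) : R := get [set y | y_eq a y].

Lemma y_eqP (a : R) : 0 <= a <= 1 ->
  y_eq a (y_ a) /\ forall y, y_eq a y -> y = y_ a.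
Proof.
move=> /andP[a0 a1].
pose f (y : R) : R := y - sin (- pi * y) / pi.
have pi0 : pi != 0 :> R by rewrite gt_eqF// pi_gt0.
have f' (y : R) : is_derive y 1 f (1 + cos (pi * y)).
  rewrite /f; apply: is_derive_eq.
  rewrite /GRing.scale /= !mulNr cosN.
  by rewrite !(mulr0, oppr0, add0r, mulr1) !mulrN opprK mulrCA mulVf ?mulr1.
have cf : {within `[0, 1], continuous f}.
  apply: continuous_subspaceT => y; apply: differentiable_continuous.
  by apply/derivable1_diffP; exact: ex_derive.
have f_incr : forall x y, 0 <= x -> x < y -> y <= 1 -> f x < f y.
  apply: gtr0_derive1_incr => // x x01; rewrite derive1E derive_val.
  have /andP[x0 x1] : 0 < x < 1 by rewrite in_itv in x01.
  suff : cos pi < cos (pi * x) by rewrite cospi; lra.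
  have xpi : pi * x < pi by rewrite gtr_pMr ?pi_gt0.
  rewrite ltr_cos // in_itv /= ?pi_ge0 ?lexx //.
  by rewrite mulr_ge0 ?pi_ge0 ?ltW.
have ex : exists y, y_eq a y.
  have f0 : f 0 = 0 by rewrite /f mulr0 sin0; ring.
  have f1 : f 1 = 1 by rewrite /f mulr1 sinN sinpi; ring.
  have [||y y01 fy] := @IVT R f 0 1 `|2 * a - 1| _ cf.
  - exact: ler01.
  - rewrite f0 f1 (min_idPl ler01) (max_idPr ler01) normr_ge0 /=.
    by rewrite ler_norml; apply/andP; split; lra.
  - by exists y; split => //; rewrite in_itv in y01.
have ya : y_eq a (y_ a) := getPex ex.
split=> // y [/andP[y0 y1] fy]; case: ya => /andP[z0 z1] fz.
have [yz|zy|//] := ltgtP y (y_ a).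
- by have := f_incr _ _ y0 yz z1; rewrite /f fy fz ltxx.
- by have := f_incr _ _ z0 zy y1; rewrite /f fy fz ltxx.
Qed.

Definition w_ (a : R) : R := 2 / (y_ a + 1).

(* J is the supremum of the Fisher information; the bound is 0 when it is
   infinite. *)
Definition lower_bound (delta : R) (n : nat) (J : \bar R) : \bar R :=
  if J is j%:E%E then
    ereal_sup [set (a ^+ 2 / (4 * pi ^+ 2 * delta ^- 2 * w_ a ^- 2 + n%:R * j))%:E
              | a in `[0, 1]]
  else 0%E.

End bound.

(* Main.v *)
Require Import Defs.
From HB Require Import structures.
From mathcomp Require Import all_boot all_order all_algebra.
From mathcomp Require Import ring lra.
From mathcomp Require Import all_classical all_reals all_analysis.
From mathcomp Require Import measurable_realfun.
Import Order.TTheory GRing.Theory Num.Theory.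
Import numFieldNormedType.Exports.
Local Open Scope classical_set_scope.
Local Open Scope ring_scope.

(** Fix an estimator [t], let [m theta] be its mean, [psi = Num.max 0], [r] its
    maximal risk, [N = n * J] with [J] the supremum of the Fisher information;
    if [r] or [J] is infinite there is nothing to show.  The variance at [theta]
    is at most [r - (m theta - psi theta) ^+ 2].  The Cramer-Rao inequality
    bounds [(m^`()) ^+ 2] by [N] times the variance, so that for every [u > 0]
      [m^`() <= N / (2 * u) + u * (r - (m - psi) ^+ 2) / 2].
    The estimator has now disappeared, and what remains is a statement about one
    real function [m].  Multiply by a weight [k] that vanishes at the ends of an
    interval: the integral of [(m * k)^`()] is zero, and the quadratic bias term
    absorbs [(m - psi) * k^`()].  This is van Trees' inequality for the prior
    proportional to [k], and [k = 1 + cos (pi * (theta - c) / W)] on an interval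
    of length [2 * W] ending at [delta] gives the claimed constant: the equation
    defining [y_ a] makes the prior probability of [theta > 0] equal to the
    larger of [a] and [1 - a], for [W = delta / (1 + y_ a)].

    The model is only assumed to be Hellinger differentiable at each point, so
    neither joint measurability of the densities nor differentiability of [m] is
    at hand, and no integral over [theta] is formed.  Instead,
    - [affinity_iid] bounds from below, through the Hellinger affinity, how
      small two nonnegative functions can be on average under two product laws;
      applied to shifted squares of [t] it gives [mean_diff_le], a Cramer-Rao
      inequality for differences of means;
    - [sqr_hellinger_near] extracts from Hellinger differentiability the only
      local fact used, a bound on the Hellinger distance, and [mean_slope]
      combines the two into a bound for the difference quotients of [m];
    - [upper_slope_nonincr] replaces integration: a function whose difference
      quotients have upper limit at most 0 everywhere is nonincreasing.  It is
      applied in [weighted_mean_increment] to [m * k] minus an explicit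
      antiderivative, and [van_trees_max] evaluates the result. *)

Set Implicit Arguments.
Unset Strict Implicit.
Unset Printing Implicit Defensive.

(** * Integration against a density *)

Lemma measurable_sqrt (R : realType) : measurable_fun setT (@Num.sqrt R).
Proof. by apply: continuous_measurable_fun; exact: sqrt_continuous. Qed.

Section integral_density.
Local Open Scope ereal_scope.
Context (d : measure_display) (T : measurableType d) (R : realType).
Variables (nu : {measure set T -> \bar R}) (p : T -> R) (P : probability T R).
Hypothesis pP : is_density nu p P.

Import HBNNSimple.

Lemma integral_density_nnsfun (h : {nnsfun T >-> R}) :
  \int[P]_x (h x)%:E = \int[nu]_x ((h x)%:E * (p x)%:E).
Proof.
have [mp p0 PE] := pP.
have mp' : measurable_fun setT (fun x => (p x)%:E) by exact/measurable_EFinP.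
transitivity (\int[P]_x
    (\sum_(r \in range h) (r * \1_(h @^-1` [set r]) x)%:E)).
  by apply: eq_integral => x _; rewrite fsumEFin// -fimfunE.
rewrite ge0_integral_fsum//; last 2 first.
- by move=> r; exact/measurable_EFinP/measurable_funM.
- by move=> r x _; exact: nnfun_muleindic_ge0.
transitivity (\int[nu]_x
    (\sum_(r \in range h) (r * \1_(h @^-1` [set r]) x)%:E * (p x)%:E)).
  rewrite ge0_integral_fsum//; last 2 first.
  - move=> r; apply: emeasurable_funM => //.
    exact/measurable_EFinP/measurable_funM.
  - by move=> r x _; rewrite mule_ge0 ?lee_fin// -lee_fin nnfun_muleindic_ge0.
  apply: eq_fsbigr => r /[!inE] -[t _ <-].
  under eq_integral do rewrite EFinM.
  rewrite integralZl_indic_nnsfun// integral_indic// setIT.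
  under [RHS]eq_integral do rewrite EFinM -muleA.
  rewrite ge0_integralZl ?lee_fin//; last 2 first.
  - by apply: emeasurable_funM => //; exact/measurable_EFinP.
  - by move=> x _; rewrite mule_ge0 ?lee_fin.
  congr (_ * _); rewrite [LHS]PE// integral_mkcond; apply: eq_integral => x _.
  by rewrite epatch_indic muleC.
apply: eq_integral => x _; rewrite -ge0_mule_fsuml; last first.
  by move=> r; exact: nnfun_muleindic_ge0.
by rewrite fsumEFin// -fimfunE.
Qed.

Lemma integral_density (f : T -> \bar R) :
  measurable_fun setT f -> (forall x, 0 <= f x) ->
  \int[P]_x f x = \int[nu]_x (f x * (p x)%:E).
Proof.
move=> mf f0; have [mp p0 _] := pP.
pose h := nnsfun_approx measurableT mf.
have hf x : (h n x)%:E @[n --> \oo] --> f x.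
  by apply: cvg_nnsfun_approx => // y _; exact: f0.
transitivity (limn (fun n => \int[P]_x (h n x)%:E)).
  rewrite -monotone_convergence//.
  - by apply: eq_integral => x _; exact/esym/cvg_lim.
  - by move=> n; exact/measurable_EFinP.
  - by move=> n x _; rewrite lee_fin.
  - by move=> x _ a b ab; rewrite lee_fin; exact/lefP/nd_nnsfun_approx.
under eq_fun do rewrite integral_density_nnsfun.
rewrite -monotone_convergence//.
- apply: eq_integral => x _; apply/cvg_lim => //.
  by apply: cvgeZr => //; exact: hf.
- by move=> n; apply: emeasurable_funM; exact/measurable_EFinP.
- by move=> n x _; rewrite mule_ge0 ?lee_fin.
- move=> x _ a b ab; rewrite lee_wpmul2r ?lee_fin//.
  exact/lefP/nd_nnsfun_approx.
Qed.

End integral_density.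

(** * Affinity of product laws *)

Section iid.
Local Open Scope ereal_scope.
Context (d : measure_display) (T : measurableType d) (R : realType).

Lemma ge0_integral_iidS (P : probability T R) n (f : n.+1.-tuple T -> \bar R) :
  measurable_fun setT f -> (forall x, 0 <= f x) ->
  \int[iid_law P n.+1]_x f x =
  \int[P]_x \int[iid_law P n]_xs f (tcons (x, xs)).
Proof.
move=> mf f0 /=.
rewrite (ge0_integral_distribution (P := P \x iid_law P n) (@tcons _ _ n))//.
rewrite (fubini_tonelli1 (f \o @tcons _ _ n))// => [|x]; last exact: f0.
by apply: measurableT_comp => //; exact: measurable_tcons.
Qed.

Lemma measurable_integral_iid (P : probability T R) n
    (f : n.+1.-tuple T -> \bar R) :
  measurable_fun setT f -> (forall x, 0 <= f x) ->
  measurable_fun setT (fun x => \int[iid_law P n]_xs f (tcons (x, xs))).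
Proof.
move=> mf f0.
apply: (measurable_fun_fubini_tonelli_F (f \o @tcons _ _ n)) => [|x].
  by apply: measurableT_comp => //; exact: measurable_tcons.
exact: f0.
Qed.

Lemma measurable_integral_iid_section n (f : n.+1.-tuple T -> \bar R) x :
  measurable_fun setT f -> measurable_fun setT (fun xs => f (tcons (x, xs))).
Proof.
move=> mf; apply: measurableT_comp => //.
exact: (measurableT_comp (@measurable_tcons _ T n) (measurable_pair1 x)).
Qed.

Section affinity.
Variables (nu : {measure set T -> \bar R}) (p1 p2 : T -> R).
Variables (P1 P2 : probability T R).
Hypotheses (pP1 : is_density nu p1 P1) (pP2 : is_density nu p2 P2).

Let rho := \int[nu]_x (Num.sqrt (p1 x) * Num.sqrt (p2 x))%:E.

(** The hypothesis on [f] and [g] says [q <= 2 * sqrt (f * g)], written so that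
    it is homogeneous and makes sense for extended reals.  In this form it
    passes through the integration of one coordinate: at a point [x], the
    integrand [s * F x * p1 x + s^-1 * G x * p2 x] equals
    [sqrt (p1 x) * sqrt (p2 x)] times the same expression in [F x] and [G x]
    for the parameter [s * sqrt (p1 x) / sqrt (p2 x)].  This is why the affinity
    of two product laws can be used without densities for these laws. *)
Lemma affinity_iid n (f g : n.-tuple T -> \bar R) (q : \bar R) :
  measurable_fun setT f -> measurable_fun setT g ->
  (forall x, 0 <= f x) -> (forall x, 0 <= g x) -> 0 <= q ->
  (forall x (s : R), (0 < s)%R -> q <= s%:E * f x + s^-1%:E * g x) ->
  forall s : R, (0 < s)%R ->
  q * rho ^+ n <= s%:E * \int[iid_law P1 n]_x f x
                + s^-1%:E * \int[iid_law P2 n]_x g x.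
Proof.
have [mp1 p10 _] := pP1; have [mp2 p20 _] := pP2.
elim: n f g => [|n IHn] f g mf mg f0 g0 q0 fg s s0.
  by rewrite expe0 mule1 !integral_dirac//= !diracE !in_setT !mul1e; exact: fg.
have s0w : (0 <= s)%R by exact: ltW.
have s0' : (0 <= s^-1)%R by rewrite invr_ge0.
have rho0 : 0 <= rho.
  by apply: integral_ge0 => x _; rewrite lee_fin mulr_ge0// sqrtr_ge0.
pose F x := \int[iid_law P1 n]_xs f (tcons (x, xs)).
pose G x := \int[iid_law P2 n]_xs g (tcons (x, xs)).
have F0 x : 0 <= F x by exact: integral_ge0.
have G0 x : 0 <= G x by exact: integral_ge0.
have mF : measurable_fun setT F by exact: measurable_integral_iid.
have mG : measurable_fun setT G by exact: measurable_integral_iid.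
have FG x r : (0 < r)%R -> q * rho ^+ n <= r%:E * F x + r^-1%:E * G x.
  move=> r0; apply: IHn => //; do ? exact: measurable_integral_iid_section.
  by move=> xs t t0; exact: fg.
rewrite !ge0_integral_iidS// -/F -/G.
rewrite (integral_density pP1 mF F0) (integral_density pP2 mG G0).
have mFp : measurable_fun setT (fun x => F x * (p1 x)%:E).
  by apply: emeasurable_funM => //; exact/measurable_EFinP.
have mGp : measurable_fun setT (fun x => G x * (p2 x)%:E).
  by apply: emeasurable_funM => //; exact/measurable_EFinP.
have Fp0 x : 0 <= F x * (p1 x)%:E by rewrite mule_ge0 ?lee_fin.
have Gp0 x : 0 <= G x * (p2 x)%:E by rewrite mule_ge0 ?lee_fin.
rewrite -!ge0_integralZl_EFin//.
rewrite -ge0_integralD//; last 4 first.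
- by move=> x _; rewrite mule_ge0 ?lee_fin.
- exact: measurable_funeM.
- by move=> x _; rewrite mule_ge0 ?lee_fin.
- exact: measurable_funeM.
have mr : measurable_fun setT
    (fun x => (Num.sqrt (p1 x) * Num.sqrt (p2 x))%:E).
  apply/measurable_EFinP.
  apply: measurable_funM.
    exact: (measurableT_comp (@measurable_sqrt R) mp1).
  exact: (measurableT_comp (@measurable_sqrt R) mp2).
have c0 : 0 <= q * rho ^+ n by rewrite mule_ge0// expe_ge0.
have -> : q * rho ^+ n.+1 = \int[nu]_x ((q * rho ^+ n) *
    (Num.sqrt (p1 x) * Num.sqrt (p2 x))%:E).
  by rewrite ge0_integralZl// expeS muleCA muleC.
apply: ge0_le_integral => //.
- by move=> x _; rewrite mule_ge0// lee_fin mulr_ge0// sqrtr_ge0.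
- exact: measurable_funeM.
- by apply: emeasurable_funD; exact: measurable_funeM.
move=> x _.
have RHS0 : 0 <= s%:E * (F x * (p1 x)%:E) + s^-1%:E * (G x * (p2 x)%:E).
  by rewrite adde_ge0// mule_ge0 ?lee_fin.
(* a vanishing density makes the left-hand side zero; otherwise rescale s *)
have [p1x|p1x] := eqVneq (p1 x) 0%R.
  by rewrite p1x sqrtr0 mul0r mule0 -p1x.
have [p2x|p2x] := eqVneq (p2 x) 0%R.
  by rewrite p2x sqrtr0 mulr0 mule0 -p2x.
set a := Num.sqrt (p1 x); set b := Num.sqrt (p2 x).
have a0 : (0 < a)%R by rewrite sqrtr_gt0 lt_neqAle eq_sym p1x p10.
have b0 : (0 < b)%R by rewrite sqrtr_gt0 lt_neqAle eq_sym p2x p20.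
have aE : p1 x = (a * a)%R by rewrite -expr2 sqr_sqrtr.
have bE : p2 x = (b * b)%R by rewrite -expr2 sqr_sqrtr.
have r0 : (0 < s * a / b)%R by rewrite divr_gt0 ?mulr_gt0.
have ab0 : 0 <= (a * b)%:E by rewrite lee_fin mulr_ge0 ?ltW.
apply: le_trans (lee_wpmul2r ab0 (FG x _ r0)) _.
rewrite ge0_muleDl; last 2 first.
- by rewrite mule_ge0// lee_fin ltW.
- by rewrite mule_ge0// lee_fin invr_ge0 ltW.
rewrite aE bE !(muleC (F x)) !(muleC (G x)) !muleA -!EFinM.
rewrite muleAC -EFinM [X in _ + X]muleAC -EFinM.
rewrite le_eqVlt; apply/orP; left; apply/eqP; congr (_%:E * _ + _%:E * _);
  by field; rewrite ?gt_eqF.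
Qed.

End affinity.

End iid.

(** * Two-point inequality for means *)

Section second_moment.
Context (d : measure_display) (T : measurableType d) (R : realType).
Variables (P : probability T R) (t : T -> R) (c : R).
Hypotheses (mt : measurable_fun setT t)
  (t2 : P.-integrable setT (fun x => ((t x - c) ^+ 2)%:E)).

Lemma sqr_integrable_integrable : P.-integrable setT (EFin \o t).
Proof.
have i1 : P.-integrable setT (fun x => ((t x - c) ^+ 2)%:E + (1 + `|c|)%:E)%E.
  apply: integrableD => //; exact: finite_measure_integrable_cst.
apply: le_integrable i1 => //; first exact/measurable_EFinP.
move=> x _; rewrite /= lee_fin.
have ty : `|t x| <= `|t x - c| + `|c|.
  by rewrite -{1}(subrK c (t x)); exact: ler_normD.
apply: le_trans (ler_norm _); apply: le_trans ty _.
rewrite addrA lerD2r -(real_normK (num_real (t x - c))).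
by have := sqr_ge0 (`|t x - c| - 1 / 2); nra.
Qed.

Lemma second_moment_shift b :
  P.-integrable setT (fun x => ((t x - b) ^+ 2)%:E) /\
  \int[P]_x ((t x - b) ^+ 2) = \int[P]_x ((t x - c) ^+ 2)
    + 2 * (\int[P]_x (t x) - c) * (c - b) + (c - b) ^+ 2.
Proof.
have it := sqr_integrable_integrable.
have il : P.-integrable setT (EFin \o (fun x => 2 * (c - b) * t x)).
  rewrite [X in _.-integrable _ X](_ : _ =
    fun x => (2 * (c - b))%:E * (t x)%:E)%E//.
  exact: integrableZl.
have ic : P.-integrable setT (EFin \o (fun=> (c - b) * (- b - c))).
  exact: finite_measure_integrable_cst.
have ib : P.-integrable setT
    (EFin \o (fun x => 2 * (c - b) * t x + (c - b) * (- b - c))).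
  exact: (integrableD measurableT il ic).
have tbE x : (t x - b) ^+ 2
    = (t x - c) ^+ 2 + (2 * (c - b) * t x + (c - b) * (- b - c)).
  by ring.
split.
  by under eq_fun do rewrite tbE EFinD; exact: integrableD.
under eq_Rintegral do rewrite tbE.
rewrite RintegralD// RintegralD//.
rewrite RintegralZl// Rintegral_cst//.
have -> : fine (P setT) = 1 by rewrite probability_setT.
by ring.
Qed.

End second_moment.

Lemma bernoulli_ineq (R : realDomainType) (r : R) n :
  0 <= r -> 1 - n%:R * (1 - r) <= r ^+ n.
Proof.
move=> r0; elim: n => [|n IHn]; first by rewrite mul0r subr0.
rewrite exprS; apply: le_trans (ler_wpM2l r0 IHn).
have : 0 <= n%:R * (1 - r) ^+ 2 by rewrite mulr_ge0 ?sqr_ge0.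
by rewrite -natr1; lra.
Qed.

Section hellinger.
Context (d : measure_display) (T : measurableType d) (R : realType).
Variables (nu : {measure set T -> \bar R}).

Definition sqr_hellinger (p1 p2 : T -> R) : R :=
  \int[nu]_x (Num.sqrt (p1 x) - Num.sqrt (p2 x)) ^+ 2.

Section two_densities.
Variables (p1 p2 : T -> R) (P1 P2 : probability T R).
Hypotheses (pP1 : is_density nu p1 P1) (pP2 : is_density nu p2 P2).

Lemma measurable_sqrt_density (p : T -> R) (P : probability T R) :
  is_density nu p P -> measurable_fun setT (fun x => Num.sqrt (p x)).
Proof. by case=> mp _ _; exact: (measurableT_comp (@measurable_sqrt R) mp). Qed.

(** Stated with extended integrals, so that it also yields the finiteness of
    both terms. *)
Lemma hellinger_affinity :
  (\int[nu]_x ((Num.sqrt (p1 x) - Num.sqrt (p2 x)) ^+ 2)%:E +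
   2%:E * \int[nu]_x (Num.sqrt (p1 x) * Num.sqrt (p2 x))%:E = 2%:E)%E.
Proof.
have [mp1 p10 P1E] := pP1; have [mp2 p20 P2E] := pP2.
have ms1 := measurable_sqrt_density pP1.
have ms2 := measurable_sqrt_density pP2.
have mr : measurable_fun setT (fun x => Num.sqrt (p1 x) * Num.sqrt (p2 x)).
  exact: measurable_funM.
rewrite -ge0_integralZl_EFin//; last exact/measurable_EFinP.
rewrite -ge0_integralD//; last 3 first.
- by move=> x _; rewrite lee_fin sqr_ge0.
- apply/measurable_EFinP; apply: measurable_funX; exact: measurable_funB.
- by apply: measurable_funeM; exact/measurable_EFinP.
transitivity (\int[nu]_x ((p1 x)%:E + (p2 x)%:E))%E.
  apply: eq_integral => x _; rewrite -EFinM -!EFinD; congr EFin.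
  rewrite -[in RHS](sqr_sqrtr (p10 x)) -[in RHS](sqr_sqrtr (p20 x)).
  by ring.
rewrite ge0_integralD//; last 4 first.
- by move=> x _; rewrite lee_fin.
- exact/measurable_EFinP.
- by move=> x _; rewrite lee_fin.
- exact/measurable_EFinP.
rewrite -P1E// -P2E// [X in (X + _)%E](_ : _ = 1%E); last first.
  exact: probability_setT.
by rewrite [X in (_ + X)%E](_ : _ = 1%E)//; exact: probability_setT.
Qed.

Lemma sqr_hellingerE :
  (\int[nu]_x ((Num.sqrt (p1 x) - Num.sqrt (p2 x)) ^+ 2)%:E =
   (sqr_hellinger p1 p2)%:E)%E.
Proof.
rewrite fineK// ge0_fin_numE; last first.
  by apply: integral_ge0 => x _; rewrite lee_fin sqr_ge0.
apply: (@le_lt_trans _ _ 2%:E)%E; last exact: ltry.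
by rewrite -hellinger_affinity leeDl// mule_ge0// integral_ge0.
Qed.

(** Tensorization: the squared Hellinger distance of [n]-fold products is at
    most [n] times that of the factors. *)
Lemma affinity_iid_ge n :
  ((1 - n%:R * (sqr_hellinger p1 p2 / 2))%:E <=
   (\int[nu]_x (Num.sqrt (p1 x) * Num.sqrt (p2 x))%:E) ^+ n)%E.
Proof.
have := hellinger_affinity; rewrite sqr_hellingerE.
set r := (\int[nu]_x _)%E => h.
have : (0 <= r)%E.
  by apply: integral_ge0 => x _; rewrite lee_fin mulr_ge0// sqrtr_ge0.
move: h; case: r => [r||] //; last by rewrite mulry gtr0_sg// mul1e.
rewrite -EFinM -EFinD => -[h]; rewrite lee_fin => r0.
rewrite -EFin_expe lee_fin; apply: le_trans (bernoulli_ineq n r0).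
by rewrite (_ : sqr_hellinger p1 p2 / 2 = 1 - r)//; lra.
Qed.

(** A finite-difference Cramer-Rao inequality.  It is [affinity_iid] for
    [(t - c -/+ l / 2) ^+ 2 + l ^+ 2 / 4]: expanding the squares, the terms in
    [l ^+ 2] cancel up to the Hellinger term, and the cross terms leave the
    difference of the means.  The free [l] is the multiplier of an
    arithmetic-geometric mean inequality; keeping it avoids square roots. *)
Lemma mean_diff_le n (t : n.-tuple T -> R) (b c l : R) :
  measurable_fun setT t ->
  (iid_law P1 n).-integrable setT (fun x => ((t x - b) ^+ 2)%:E) ->
  (iid_law P2 n).-integrable setT (fun x => ((t x - b) ^+ 2)%:E) ->
  l * (\int[iid_law P1 n]_x (t x) - \int[iid_law P2 n]_x (t x)) <=
  \int[iid_law P1 n]_x ((t x - c) ^+ 2) + \int[iid_law P2 n]_x ((t x - c) ^+ 2)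
  + l ^+ 2 * n%:R * sqr_hellinger p1 p2 / 2.
Proof.
move=> mt it1 it2.
have [ic1 _] := second_moment_shift mt it1 c.
have [ic2 _] := second_moment_shift mt it2 c.
pose f x : \bar R := ((t x - (c + l / 2)) ^+ 2 + l ^+ 2 / 4)%:E.
pose g x : \bar R := ((t x - (c - l / 2)) ^+ 2 + l ^+ 2 / 4)%:E.
have mf : measurable_fun setT f.
  apply/measurable_EFinP; apply: measurable_funD => //.
  by apply: measurable_funX; exact: measurable_funB.
have mg : measurable_fun setT g.
  apply/measurable_EFinP; apply: measurable_funD => //.
  by apply: measurable_funX; exact: measurable_funB.
have fg0 (y : R) : 0 <= y ^+ 2 + l ^+ 2 / 4.
  by rewrite addr_ge0 ?divr_ge0 ?sqr_ge0.
have integ (P : probability (n.-tuple T) R) e :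
    P.-integrable setT (fun x => ((t x - c) ^+ 2)%:E) ->
    (\int[P]_x ((t x - e) ^+ 2 + l ^+ 2 / 4)%:E = (\int[P]_x ((t x - c) ^+ 2)
    + 2 * (\int[P]_x (t x) - c) * (c - e) + (c - e) ^+ 2 + l ^+ 2 / 4)%:E)%E.
  move=> ic; have [ie <-] := second_moment_shift mt ic e.
  under eq_integral do rewrite EFinD.
  rewrite integralD//; last exact: finite_measure_integrable_cst.
  rewrite integral_cst// [X in (_ * X)%E](_ : _ = 1%E) ?mule1; last first.
    exact: probability_setT.
  by rewrite EFinD /Rintegral fineK//; exact: integrable_fin_num.
have fgq x (s : R) : 0 < s ->
    ((l ^+ 2)%:E <= s%:E * f x + s^-1%:E * g x)%E.
  move=> s0; rewrite /f /g -!EFinM -EFinD lee_fin.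
  rewrite -(ler_pM2l s0) mulrDr mulrA (mulrA s s^-1) mulfV ?gt_eqF// mul1r.
  set a := t x - c.
  have := sqr_ge0 (l * (s - 1) - a * (s + 1)).
  have := sqr_ge0 (a * (s - 1)).
  rewrite (_ : t x - (c + l / 2) = a - l / 2); last by rewrite /a; ring.
  rewrite (_ : t x - (c - l / 2) = a + l / 2); last by rewrite /a; ring.
  by nra.
have := affinity_iid pP1 pP2 mf mg (fun x => fg0 _) (fun x => fg0 _)
  _ fgq ltr01.
rewrite lee_fin sqr_ge0 invr1 !mul1e => /(_ isT).
have l2 : (0 <= (l ^+ 2)%:E :> \bar R)%E by rewrite lee_fin sqr_ge0.
move/(le_trans (lee_wpmul2l l2 (affinity_iid_ge n))).
rewrite !integ// -EFinM -EFinD lee_fin.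
by lra.
Qed.

End two_densities.
End hellinger.

(** * Local bounds at a point of Hellinger differentiability *)

Section hellinger_differentiable.
Context (d : measure_display) (T : measurableType d) (R : realType).
Variables (nu : {measure set T -> \bar R}).
Variables (P : R -> probability T R) (p : R -> T -> R) (xi : T -> R) (t J : R).
Hypothesis (pP : \forall s \near t, is_density nu (p s) (P s)).
Hypothesis (dp : hellinger_derivative nu p t xi).
Hypothesis (xiJ : (fisher_information nu xi <= J%:E)%E).

(** The increment of the root density is [D = h * xi + r], and
    [D ^+ 2 <= (1 + eta) * (h * xi) ^+ 2 + (1 + eta^-1) * r ^+ 2].  The first
    term integrates to [(1 + eta) * h ^+ 2] times a quarter of the information,
    and the second is negligible once [eta] has been chosen. *)
Lemma sqr_hellinger_near e : 0 < e ->
  \forall s \near t, sqr_hellinger nu (p s) (p t) <= (J / 4 + e) * (s - t) ^+ 2.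
Proof.
move=> e0; have [xi2 /eqoP o] := dp.
have ixi := Lfun2_integrable_sqr xi2.
have mxi : measurable_fun setT xi by move/andP : xi2 => [/[!inE]].
pose I := \int[nu]_x (xi x ^+ 2).
have IE : (\int[nu]_x (xi x ^+ 2)%:E = I%:E)%E.
  by rewrite fineK//; exact: integrable_fin_num.
have I0 : 0 <= I by apply: Rintegral_ge0 => x _; exact: sqr_ge0.
have IJ : I <= J / 4.
  by move: xiJ; rewrite /fisher_information IE -EFinM lee_fin; lra.
pose eta := e / (2 * (I + 1)).
have eta0 : 0 < eta by rewrite divr_gt0// mulr_gt0// ltr_wpDl.
have etaI : eta * I <= e / 2.
  rewrite /eta -mulrA ler_pM2l// invfM -mulrA ger_pMr ?invr_gt0//.
  by rewrite mulrC ler_pdivrMr ?mul1r ?lerDl// ltr_wpDl.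
pose K := 1 + eta^-1.
have K0 : 0 < K by rewrite addr_gt0 ?invr_gt0.
have e'0 : 0 < e / 2 / K by rewrite !divr_gt0.
have pPt : is_density nu (p t) (P t) by exact: (nbhs_singleton pP).
have mst := measurable_sqrt_density pPt.
have near0 : \forall h \near (0 : R),
    is_density nu (p (t + h)) (P (t + h)) ->
    sqr_hellinger nu (p (t + h)) (p t) <= (J / 4 + e) * h ^+ 2.
  have := o _ e'0; apply: filterS => h oh pPh.
  have msh := measurable_sqrt_density pPh.
  pose D x := Num.sqrt (p (t + h) x) - Num.sqrt (p t x).
  have mD : measurable_fun setT D by exact: measurable_funB.
  pose r x := D x - h * xi x.
  have mr : measurable_fun setT r.
    by apply: measurable_funB => //; exact: measurable_funM.
  have iD : nu.-integrable setT (fun x => (D x ^+ 2)%:E).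
    apply/integrableP; split.
      by apply/measurable_EFinP; exact: measurable_funX.
    under eq_integral do rewrite /= ger0_norm ?sqr_ge0//.
    by rewrite (sqr_hellingerE pPh pPt) ltry.
  have ih : nu.-integrable setT (fun x => (h ^+ 2 * xi x ^+ 2)%:E).
    by under eq_fun do rewrite EFinM; exact: integrableZl.
  (* the real-valued integral of r ^+ 2 is the true one *)
  have ir : nu.-integrable setT (fun x => (r x ^+ 2)%:E).
    have i2 : nu.-integrable setT
        (fun x => 2%:E * ((D x ^+ 2)%:E + (h ^+ 2 * xi x ^+ 2)%:E))%E.
      by apply: integrableZl => //; exact: integrableD.
    apply: le_integrable i2 => //.
      by apply/measurable_EFinP; exact: measurable_funX.
    move=> x _; rewrite -EFinD -EFinM/= lee_fin ger0_norm ?sqr_ge0//.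
    apply: le_trans (ler_norm _).
    by rewrite /r; have := sqr_ge0 (D x + h * xi x); nra.
  rewrite /sqr_hellinger -/D.
  have -> : (J / 4 + e) * h ^+ 2
      = (J / 4 + e / 2) * h ^+ 2 + K * (e / 2 / K * h ^+ 2).
    by field; rewrite gt_eqF.
  apply: (@le_trans _ _ (\int[nu]_x
      ((1 + eta) * (h ^+ 2 * xi x ^+ 2) + K * r x ^+ 2))).
    apply: le_Rintegral => //.
      have i1 : nu.-integrable setT
          (fun x => (1 + eta)%:E * (h ^+ 2 * xi x ^+ 2)%:E)%E.
        exact: integrableZl.
      have i2 : nu.-integrable setT (fun x => K%:E * (r x ^+ 2)%:E)%E.
        exact: integrableZl.
      exact: (integrableD measurableT i1 i2).
    move=> x _; rewrite /r /K.
    set a := D x; set b := h * xi x.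
    rewrite -exprMn -/b.
    have -> : (1 + eta) * b ^+ 2 + (1 + eta^-1) * (a - b) ^+ 2 =
       a ^+ 2 + eta * (b - eta^-1 * (a - b)) ^+ 2.
      by field; rewrite gt_eqF.
    by rewrite lerDl mulr_ge0 ?sqr_ge0// ltW.
  have iz1 : nu.-integrable setT
      (EFin \o (fun x => (1 + eta) * (h ^+ 2 * xi x ^+ 2))).
    rewrite [X in _.-integrable _ X](_ : _ =
      fun x => (1 + eta)%:E * (h ^+ 2 * xi x ^+ 2)%:E)%E//; exact: integrableZl.
  have iz2 : nu.-integrable setT (EFin \o (fun x => K * r x ^+ 2)).
    rewrite [X in _.-integrable _ X](_ : _ =
      fun x => K%:E * (r x ^+ 2)%:E)%E//; exact: integrableZl.
  rewrite RintegralD// !RintegralZl// -/I lerD//.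
    rewrite mulrCA mulrC ler_wpM2r ?sqr_ge0//.
    by lra.
  rewrite ler_pM2l//; apply: le_trans (ler_norm _) _.
  by move: oh; rewrite [X in _ * X]ger0_norm ?sqr_ge0.
have near1 : \forall s \near t, is_density nu (p s) (P s) ->
    sqr_hellinger nu (p s) (p t) <= (J / 4 + e) * (s - t) ^+ 2.
  move/nbhs_ballP: near0 => [/= r r0 rS]; apply/nbhs_ballP; exists r => //= s.
  rewrite /ball/= => sr; have := rS (s - t); rewrite /ball/= subrKC; apply.
  by rewrite sub0r opprB.
by apply: filterS2 near1 pP => s; apply.
Qed.

End hellinger_differentiable.

Lemma quadratic_bound (R : realFieldType) (D A B h c : R) : h != 0 -> 0 < c ->
  (forall l, l * D <= A + l ^+ 2 * B * h ^+ 2) ->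
  `|D| <= `|h| * (A / c + c * B).
Proof.
move=> h0 c0 H.
have h0' : 0 < `|h| by rewrite normr_gt0.
have H' l : `|l| = c / `|h| -> l * D / (c / `|h|) <= `|h| * (A / c + c * B).
  move=> lE; rewrite ler_pdivrMr ?divr_gt0//; apply: le_trans (H l) _.
  rewrite -(real_normK (num_real l)) lE -(real_normK (num_real h)).
  rewrite le_eqVlt; apply/orP; left; apply/eqP.
  by field; rewrite !gt_eqF.
have c1 : 0 < c / `|h| by rewrite divr_gt0.
have := H' (c / `|h|); have := H' (- (c / `|h|)).
rewrite normrN gtr0_norm// => /(_ erefl) + /(_ erefl).
rewrite mulNr mulNr [_ * D]mulrC mulfK ?gt_eqF// => h1 h2.
by rewrite ler_norml; apply/andP; split; lra.
Qed.

Section mean_slope.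
Context (d : measure_display) (T : measurableType d) (R : realType).
Variables (nu : {measure set T -> \bar R}).
Variables (P : R -> probability T R) (p : R -> T -> R) (xi : T -> R).
Variables (psi : R -> R) (n : nat) (t : n.-tuple T -> R) (x J r : R).
Hypothesis (mt : measurable_fun setT t).
Hypothesis (pP : \forall s \near x, is_density nu (p s) (P s)).
Hypothesis (dp : hellinger_derivative nu p x xi).
Hypothesis (xiJ : (fisher_information nu xi <= J%:E)%E).
Hypothesis (risk : \forall s \near x,
  (iid_law (P s) n).-integrable setT (fun y => ((t y - psi s) ^+ 2)%:E) /\
  \int[iid_law (P s) n]_y ((t y - psi s) ^+ 2) <= r).
Hypothesis (cpsi : psi @ x --> psi x).

Let m s := \int[iid_law (P s) n]_y (t y).

Lemma mean_diff_near c e : 0 < e ->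
  \forall s \near x, forall l,
  l * (m s - m x) <=
   r + 2 * (m s - psi s) * (psi s - c) + (psi s - c) ^+ 2
   + (r + 2 * (m x - psi x) * (psi x - c) + (psi x - c) ^+ 2)
   + l ^+ 2 * (n%:R * (J / 4 + e) / 2) * (s - x) ^+ 2.
Proof.
move=> e0.
have pPx := nbhs_singleton pP.
have [ix rx] := nbhs_singleton risk.
apply: filterS3 (sqr_hellinger_near pP dp xiJ e0) pP risk
  => s hs pPs [is_ rs] l.
have [is1 _] := second_moment_shift mt is_ (psi x).
have := mean_diff_le pPs pPx c l mt is1 ix.
rewrite -/(m s) -/(m x).
have [_ ->] := second_moment_shift mt is_ c.
have [_ ->] := second_moment_shift mt ix c.
rewrite -/(m s) -/(m x) => /le_trans; apply.
apply: lerD; first by apply: lerD; rewrite !lerD2r.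
have : l ^+ 2 * n%:R / 2 * sqr_hellinger nu (p s) (p x)
    <= l ^+ 2 * n%:R / 2 * ((J / 4 + e) * (s - x) ^+ 2).
  by rewrite ler_wpM2l// divr_ge0// mulr_ge0// sqr_ge0.
by lra.
Qed.

Lemma sqr_bias_le : \forall s \near x, (m s - psi s) ^+ 2 <= r.
Proof.
apply: filterS risk => s [is_ rs].
have [_] := second_moment_shift mt is_ (m s); rewrite -/(m s) => h.
have : 0 <= \int[iid_law (P s) n]_y ((t y - m s) ^+ 2).
  by apply: Rintegral_ge0 => y _; exact: sqr_ge0.
by rewrite h; lra.
Qed.

(** A crude Lipschitz bound at [x], from the centre [c = psi x].  The sharp
    bound of [mean_slope] is centred at [m x] and needs a continuous bias. *)
Lemma mean_continuous : m @ x --> m x.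
Proof.
have r0 : 0 <= r.
  by apply: le_trans (nbhs_singleton sqr_bias_le); exact: sqr_ge0.
pose K : R := (3 * r + 2) + n%:R * (J / 4 + 1) / 2.
have near1 : \forall s \near x, `|psi s - psi x| < 1.
  move/cvgrPdist_lt : cpsi => /(_ 1 ltr01).
  by apply: filterS => s; rewrite distrC.
have lip : \forall s \near x, `|m s - m x| <= `|s - x| * K.
  apply: filterS3 (mean_diff_near (psi x) ltr01) sqr_bias_le near1 => s H bs ps.
  have [->|sx] := eqVneq s x; first by rewrite subrr normr0 subrr normr0 mul0r.
  rewrite /K -[3 * r + 2]divr1 -[_ * _ / 2]mul1r.
  apply: quadratic_bound => //; first by rewrite subr_eq0.
  move=> l; apply: le_trans (H l) _; rewrite lerD2r.
  move: ps; rewrite ltr_norml => /andP[p1 p2].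
  set y := psi s - psi x in p1 p2 *; set b := m s - psi s in bs *.
  have := sqr_ge0 (b - y); rewrite subrr; nra.
apply/cvgrPdist_le => e e0.
have K0 : 0 < `|K| + 1 by rewrite ltr_wpDl.
have ek : 0 < e / (`|K| + 1) by rewrite divr_gt0.
have near2 : \forall s \near x, `|s - x| < e / (`|K| + 1).
  by apply/nbhs_ballP; exists (e / (`|K| + 1)) => //= s; rewrite /ball/= distrC.
apply: filterS2 lip near2 => s H1 H2.
rewrite distrC (le_trans H1)// (@le_trans _ _ (`|s - x| * (`|K| + 1)))//.
  by rewrite ler_wpM2l// (le_trans (ler_norm _))// lerDl.
by rewrite -ler_pdivlMr// ltW.
Qed.

(** The Cramer-Rao inequality, in the form that the derivative of the mean at
    [x] is at most [n * J / (2 * u) + u * v / 2] with [v] the variance, and with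
    the variance bounded by [r] minus the squared bias.  The variance at nearby
    points is never compared with the variance at [x], for which there is no
    continuity: only the bound [r - bias ^+ 2] is, and it is continuous. *)
Lemma mean_slope u e : 0 < u -> 0 < e -> \forall s \near x,
  `|m s - m x| <=
  `|s - x| * (n%:R * J / (2 * u) + u * (r - (m x - psi x) ^+ 2) / 2 + e).
Proof.
move=> u0 e0.
pose e1 := 2 * e / u; pose e2 := e * u / (4 * (n%:R + 1)).
have n1 : 0 < n%:R + 1 :> R by rewrite ltr_wpDl.
have e10 : 0 < e1 by rewrite !(divr_gt0, mulr_gt0).
have e20 : 0 < e2 by rewrite !(divr_gt0, mulr_gt0).
pose f s := 2 * (m s - psi s) * (psi s - m x) + (psi s - m x) * (psi s - m x).
have cf : f @ x --> f x.
  have c1 : (fun s => psi s - m x) @ x --> psi x - m x.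
    by apply: cvgB => //; exact: cvg_cst.
  apply: cvgD; last exact: cvgM.
  apply: cvgM => //; apply: cvgM; first exact: cvg_cst.
  by apply: cvgB => //; exact: mean_continuous.
have near1 : \forall s \near x, f s < f x + e1.
  move/cvgrPdist_lt : cf => /(_ _ e10); apply: filterS => s.
  by rewrite distrC ltr_norml => /andP[_]; lra.
apply: filterS2 (mean_diff_near (m x) e20) near1 => s H fs.
have [->|sx] := eqVneq s x; first by rewrite subrr normr0 subrr normr0 mul0r.
(* c = 4 / u turns A / c and c * B into the two announced terms *)
have c0 : 0 < 4 / u by rewrite divr_gt0.
have sx0 : s - x != 0 by rewrite subr_eq0.
have := @quadratic_bound _ (m s - m x) (2 * (r - (m x - psi x) ^+ 2) + e1)
  (n%:R * (J / 4 + e2) / 2) _ _ sx0 c0.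
move=> /(_ _) /le_trans; apply.
  move=> l; apply: le_trans (H l) _; rewrite lerD2r.
  by move: fs; rewrite /f; lra.
rewrite ler_wpM2l//.
have -> : (2 * (r - (m x - psi x) ^+ 2) + e1) / (4 / u)
   = u * (r - (m x - psi x) ^+ 2) / 2 + e / 2.
  by rewrite /e1; field; rewrite gt_eqF.
have -> : 4 / u * (n%:R * (J / 4 + e2) / 2)
    = n%:R * J / (2 * u) + e / 2 * (n%:R / (n%:R + 1)).
  by rewrite /e2; field; rewrite !gt_eqF.
have : n%:R / (n%:R + 1) <= 1 :> R by rewrite ler_pdivrMr// mul1r lerDl.
by nra.
Qed.

End mean_slope.

(** * Monotonicity from difference quotients *)

Section slopes.
Context (R : realType).
Implicit Types (F G k m : R -> R) (a b x : R).

(** All difference quotients at [x], on both sides, have upper limit at most 0;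
    multiplying by [(s - x) ^+ 2] treats the two sides at once. *)
Definition upper_slope_le0 F x := forall e, 0 < e ->
  \forall s \near x, (F s - F x) * (s - x) <= e * (s - x) ^+ 2.

(** Given [e], the points up to which [F] grows at rate at most [e] have a
    supremum; the bound on the left of it shows that it is one of them, the
    bound on the right that it is [b].  No continuity of [F] is needed, because
    the slopes are controlled on both sides. *)
Lemma upper_slope_nonincr F a b : a <= b ->
  (forall x, a <= x <= b -> upper_slope_le0 F x) -> F b <= F a.
Proof.
move=> ab HF.
suff H e : 0 < e -> F b - F a <= e * (b - a).
  have [->//|ab'] := eqVneq a b.
  have ba0 : 0 < b - a by rewrite subr_gt0 lt_neqAle ab'.
  rewrite -subr_le0; apply/ler_addgt0Pr => e e0; rewrite add0r.
  have /H : 0 < e / (b - a) by rewrite divr_gt0.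
  by rewrite divfK// gt_eqF.
move=> e0.
pose S := [set x | a <= x <= b /\ F x - F a <= e * (x - a)].
have Sa : S a by split; rewrite ?lexx ?ab//= !subrr mulr0.
have S0 : S !=set0 by exists a.
have ubS : has_sup S by split => //; exists b => y [/andP[]].
pose c := sup S.
have ac : a <= c by apply: ub_le_sup => //; exact: ubS.2.
have cb : c <= b by apply: ge_sup => // y [/andP[]].
have /HF /(_ _ e0) /nbhs_ballP[d /= d0 dS] : a <= c <= b by rewrite ac.
have Sc : S c.
  have [y Sy ycd] := sup_adherent d0 ubS; have [/andP[ay yb] yS] := Sy.
  have yc : y <= c by apply: ub_le_sup => //; exact: ubS.2.
  split; first by rewrite ac.
  have [<-//|yc'] := eqVneq y c.
  have cy0 : 0 < c - y by rewrite subr_gt0 lt_neqAle yc'.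
  have : `|c - y| < d by rewrite gtr0_norm//; rewrite /c in ycd *; lra.
  move/(dS y) => h.
  have : F c - F y <= e * (c - y).
    rewrite -(ler_pM2r cy0); move: h; rewrite -[y - c]opprB sqrrN; lra.
  by lra.
have [cb'|cb'] := eqVneq c b; first by case: Sc => _; rewrite cb'.
have cltb : c < b by rewrite lt_neqAle cb'.
pose s := Num.min b (c + d / 2).
have cs : c < s by rewrite lt_min cltb ltrDl divr_gt0.
have sb : s <= b by rewrite ge_min lexx.
suff : s <= c by rewrite leNgt cs.
apply: ub_le_sup; first exact: ubS.2.
split; first by rewrite sb (le_trans ac)// ltW.
have sd : s <= c + d / 2 by rewrite ge_min lexx orbT.
have sc0 : 0 < s - c by rewrite subr_gt0.
have : `|c - s| < d by rewrite distrC gtr0_norm//; lra.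
move/(dS s) => h.
have : F s - F c <= e * (s - c).
  by rewrite -(ler_pM2r sc0); move: h; lra.
by have [_] := Sc; lra.
Qed.

Lemma is_derive_slope F x (f : R) e : is_derive x 1 F f -> 0 < e ->
  \forall s \near x, `|F s - F x - f * (s - x)| <= e * `|s - x|.
Proof.
move=> dF e0.
have /derivable_nbhsP : derivable F x 1 by [].
rewrite derive_val => /eqaddoP /(_ _ e0) /nbhs_ballP[d /= d0 dS].
apply/nbhs_ballP; exists d => //= s xs.
have := dS (s - x); rewrite /ball/= sub0r opprB => /(_ xs).
by rewrite !fctE /= /shift /GRing.scale/= mulr1 subrK opprD addrA mulrC.
Qed.

(** The product rule when [m] has only a bound [D] on its slopes at [x]. *)
Lemma upper_slope_mulB m k G x (D k' g : R) :
  (forall e, 0 < e -> \forall s \near x, `|m s - m x| <= `|s - x| * (D + e)) ->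
  is_derive x 1 k k' -> is_derive x 1 G g -> 0 <= k x ->
  k x * D + m x * k' <= g ->
  upper_slope_le0 (fun s => m s * k s - G s) x.
Proof.
move=> mD dk dG k0 kDg e e0.
have M0 : 0 < k x + `|m x| + 1 by rewrite ltr_wpDl// addr_ge0.
have [eta eta0 etaM] : exists2 eta, 0 < eta & eta * (k x + `|m x| + 1) = e / 2.
  exists (e / 2 / (k x + `|m x| + 1)); first by rewrite !divr_gt0.
  by rewrite divfK// gt_eqF.
pose C := (`|D| + eta) * (`|k'| + eta).
have C0 : 0 <= C by rewrite mulr_ge0// addr_ge0// ltW.
have d0 : 0 < e / (2 * (C + 1)) by rewrite divr_gt0// mulr_gt0// ltr_wpDl.
have nearx : \forall s \near x, `|s - x| < e / (2 * (C + 1)).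
  by apply/nbhs_ballP; exists (e / (2 * (C + 1))) => //= s;
    rewrite /ball/= distrC.
apply: filterS3 (filterI (mD _ eta0) nearx) (is_derive_slope dk eta0)
  (is_derive_slope dG eta0) => s [ms sx] ks Gs.
set h := s - x in ms sx ks Gs *; set H := `|h| in ms sx ks Gs.
have H0 : 0 <= H by exact: normr_ge0.
have hH : h ^+ 2 = H ^+ 2 by rewrite real_normK ?num_real.
set a := m s - m x in ms; set b := k s - k x in ks.
set q := G s - G x in Gs.
have bH : `|b| <= H * (`|k'| + eta).
  rewrite -[b](subrK (k' * h)); apply: le_trans (ler_normD _ _) _.
  by rewrite normrM -/H; lra.
have aH : `|a| <= H * (`|D| + eta).
  by apply: le_trans ms _; rewrite ler_wpM2l// lerD2r ler_norm.
have T1 : a * h * k x <= H ^+ 2 * (D + eta) * k x.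
  rewrite ler_wpM2r//; apply: le_trans (ler_norm _) _.
  by rewrite normrM -/H expr2 -mulrA mulrC ler_wpM2l.
have T2 : m x * (b - k' * h) * h <= `|m x| * eta * H ^+ 2.
  apply: le_trans (ler_norm _) _; rewrite !normrM -/H.
  by rewrite expr2 -!mulrA ler_wpM2l// (mulrA eta) ler_wpM2r.
have T3 : a * b * h <= H ^+ 2 * (C * H).
  apply: le_trans (ler_norm _) _; rewrite !normrM -/H.
  have := ler_pM (normr_ge0 a) (normr_ge0 b) aH bH.
  by move/(ler_wpM2r H0); rewrite /C; lra.
have T4 : - (q - g * h) * h <= eta * H ^+ 2.
  apply: le_trans (ler_norm _) _; rewrite normrM normrN -/H.
  by rewrite expr2 (mulrA eta) ler_wpM2r.
have CH : C * H <= e / 2.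
  apply: (@le_trans _ _ ((C + 1) * H)); first by rewrite ler_wpM2r// lerDl.
  rewrite mulrC -ler_pdivlMr ?ltr_wpDl//; apply: le_trans (ltW sx) _.
  by rewrite invfM mulrA.
have -> : (m s * k s - G s - (m x * k x - G x)) * h =
   a * h * k x + m x * (b - k' * h) * h + a * b * h + - (q - g * h) * h
   + (m x * k' - g) * h ^+ 2.
  by rewrite /a /b /q; ring.
rewrite hH.
have H2 : 0 <= H ^+ 2 by exact: sqr_ge0.
have := ler_wpM2l H2 CH; have := ler_wpM2r H2 kDg.
have : eta * (k x + `|m x| + 1) * H ^+ 2 = e / 2 * H ^+ 2 by rewrite etaM.
by lra.
Qed.

End slopes.

(** * Van Trees inequality with the squared-cosine prior *)

Section van_trees.
Context (R : realType).

Section primitive.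
Variables (w c A C kappa : R).

(** The prior density up to a factor: [2 * cos (w * (x - c) / 2) ^+ 2], which on
    an interval of length [2 * pi / w] minimizes the Fisher information of the
    prior. *)
Definition cos_weight (x : R) : R := 1 + cos (w * (x - c)).
Definition cos_weight_primitive (x : R) : R := x + sin (w * (x - c)) / w.
(** An antiderivative of the bound for the slope of [m * cos_weight] where [psi]
    is multiplication by [kappa]: [A] and [C] collect the variance and prior
    information terms, and the last summand is the integral of
    [kappa * x * cos_weight^`()]. *)
Definition weighted_bound (x : R) : R :=
  A * cos_weight_primitive x + C * (2 * x - cos_weight_primitive x)
  + kappa * (x * cos_weight x - cos_weight_primitive x).

Hypothesis w0 : w != 0.

Lemma is_derive_cos_weight (x : R) :
  is_derive x 1 cos_weight (- w * sin (w * (x - c))).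
Proof.
rewrite /cos_weight; apply: is_derive_eq.
by rewrite /GRing.scale/=; ring.
Qed.

Lemma is_derive_cos_weight_primitive (x : R) :
  is_derive x 1 cos_weight_primitive (cos_weight x).
Proof.
rewrite /cos_weight_primitive /cos_weight; apply: is_derive_eq.
by rewrite /GRing.scale/=; field.
Qed.

Lemma is_derive_weighted_bound (x : R) : is_derive x 1 weighted_bound
  (A * cos_weight x + C * (2 - cos_weight x)
   + kappa * x * (- w * sin (w * (x - c)))).
Proof.
have dk := is_derive_cos_weight x; have dK := is_derive_cos_weight_primitive x.
rewrite /weighted_bound; apply: is_derive_eq.
by rewrite /GRing.scale/=; ring.
Qed.

End primitive.

Lemma cos_weight_ge0 (w c x : R) : 0 <= cos_weight w c x.
Proof. by rewrite /cos_weight; have := cos_geN1 (w * (x - c)); lra. Qed.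

(** With [k] the weight, [k^`() ^+ 2 = w ^+ 2 * k * (2 - k)], so this is the
    arithmetic-geometric mean inequality; where [k] vanishes, so does its
    derivative. *)
Lemma cos_weight_amgm (w c x u e : R) :
  2 * u * e * (- w * sin (w * (x - c)))
  <= cos_weight w c x * (u * e) ^+ 2 + w ^+ 2 * (2 - cos_weight w c x).
Proof.
have := cos_weight_ge0 w c x; rewrite /cos_weight.
have := cos2Dsin2 (w * (x - c)).
set C := cos _; set S := sin _ => CS k0.
have [k1|k1] := eqVneq (1 + C) 0.
  have S0 : S = 0.
    have : S ^+ 2 = 0 by nra.
    by move/eqP; rewrite sqrf_eq0 => /eqP.
  by rewrite k1 S0; have := sqr_ge0 w; lra.
have kp : 0 < 1 + C by rewrite lt_neqAle eq_sym k1.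
rewrite -subr_ge0 -(pmulr_rge0 _ kp).
have -> : (1 + C) * ((1 + C) * (u * e) ^+ 2 + w ^+ 2 * (2 - (1 + C))
    - 2 * u * e * (- w * S)) =
  ((1 + C) * (u * e) + w * S) ^+ 2 + w ^+ 2 * (1 - (C ^+ 2 + S ^+ 2)).
  by ring.
by rewrite CS subrr mulr0 addr0 sqr_ge0.
Qed.

(** The slope of [m * k] is at most [D * k + m * k^`()], where
    [m * k^`() = (m - psi) * k^`() + psi * k^`()].  The bias term of [D] absorbs
    the product [(m - psi) * k^`()] by [cos_weight_amgm], and what remains does
    not depend on [m]. *)
Lemma weighted_mean_increment (m psi : R -> R) (w c N u r kappa s t : R) :
  w != 0 -> 0 < u -> s <= t ->
  (forall x, s <= x <= t -> psi x = kappa * x) ->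
  (forall x, s <= x <= t -> forall e, 0 < e -> \forall z \near x,
    `|m z - m x| <=
    `|z - x| * (N / (2 * u) + u * (r - (m x - psi x) ^+ 2) / 2 + e)) ->
  m t * cos_weight w c t - m s * cos_weight w c s <=
  weighted_bound w c (N / (2 * u) + u * r / 2) (w ^+ 2 / (2 * u)) kappa t -
  weighted_bound w c (N / (2 * u) + u * r / 2) (w ^+ 2 / (2 * u)) kappa s.
Proof.
move=> w0 u0 st psiE mslope; set G := weighted_bound _ _ _ _ _.
suff : m t * cos_weight w c t - G t <= m s * cos_weight w c s - G s by lra.
apply: (@upper_slope_nonincr _ (fun x => m x * cos_weight w c x - G x))
  => // x xst.
apply: upper_slope_mulB (mslope x xst) (is_derive_cos_weight w c x)
  (is_derive_weighted_bound _ _ _ _ w0 x) (cos_weight_ge0 _ _ _) _.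
have := cos_weight_amgm w c x u (m x - psi x).
rewrite psiE//; set k := cos_weight w c x; set k' := - w * _.
set b := m x - kappa * x.
move=> h.
have -> : k * (N / (2 * u) + u * (r - b ^+ 2) / 2) + m x * k' =
  (N / (2 * u) + u * r / 2) * k + kappa * x * k'
  + (2 * u * b * k' - k * (u * b) ^+ 2) / (2 * u).
  by rewrite /b; field; rewrite gt_eqF.
rewrite addrAC lerD2r lerD2l ler_pdivrMr ?mulr_gt0//.
have -> : w ^+ 2 / (2 * u) * (2 - k) * (2 * u) = w ^+ 2 * (2 - k).
  by field; rewrite gt_eqF.
by lra.
Qed.

Lemma ge0_right_limit (F : R -> R) : {for 0, continuous F} ->
  (forall x, 0 < x <= 1 -> 0 <= F x) -> 0 <= F 0.
Proof.
move=> cF F0; rewrite leNgt; apply/negP => Fn.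
have e0 : 0 < - F 0 by rewrite oppr_gt0.
move/cvgrPdist_lt : cF => /(_ _ e0) /nbhs_ballP[d /= d0 dS].
pose x := Num.min 1 (d / 2).
have x0 : 0 < x by rewrite lt_min ltr01 divr_gt0.
have xd : x <= d / 2 by rewrite ge_min lexx orbT.
have := dS x; rewrite /ball/= sub0r normrN gtr0_norm// => /(_ _).
have -> : x < d by lra.
move=> /(_ isT); rewrite ltr_norml => /andP[H _].
have := F0 x; rewrite x0 ge_min lexx => /(_ isT).
by lra.
Qed.

(** The prior lives between [L] and [delta], with [L = delta - 2 * W], where the
    weight vanishes at both ends.  Hence [m * k] has increment 0 in between, and
    so the increment of its bound is nonnegative; integrating [psi * k^`()] by
    parts, this increment contains minus the mass of the weight between 0 and
    [delta], namely [W * (1 + y + sin (pi * y) / pi)].  The interval is split at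
    the kink of [Num.max 0], and approached from inside, since the hypotheses
    say nothing at [-/+ delta]. *)
Lemma van_trees_max (m : R -> R) (delta y N u r B : R) :
  0 < delta -> 0 <= y <= 1 -> 0 < u ->
  (forall x, `|x| < delta -> `|m x| <= B) ->
  (forall x, `|x| < delta -> forall e, 0 < e -> \forall z \near x,
    `|m z - m x| <=
    `|z - x| * (N / (2 * u) + u * (r - (m x - Num.max 0 x) ^+ 2) / 2 + e)) ->
  1 + y + sin (pi * y) / pi <= (N + (pi * (1 + y) / delta) ^+ 2) / u + u * r.
Proof.
move=> d0 /andP[y0 y1] u0 mB mslope.
have y10 : 0 < 1 + y by rewrite ltr_pwDl.
have pi0 : 0 < pi :> R by exact: pi_gt0.
have [W W0 dW] : exists2 W, 0 < W & delta = W * (1 + y).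
  by exists (delta / (1 + y)); rewrite ?divr_gt0// divfK// gt_eqF.
pose w := pi / W; have w0 : w != 0 by rewrite gt_eqF// divr_gt0.
pose c := W * y; pose L := c - W.
have Ld : - delta <= L by rewrite /L /c dW; nra.
have L0 : L <= 0 by rewrite /L /c; nra.
pose G := weighted_bound w c (N / (2 * u) + u * r / 2) (w ^+ 2 / (2 * u)).
(* the shrunk interval has end points (1 - eta) * L and (1 - eta) * delta *)
pose Phi eta := G 1 ((1 - eta) * delta) - G 1 0 + (G 0 0 - G 0 ((1 - eta) * L))
  + B * (cos_weight w c ((1 - eta) * delta) + cos_weight w c ((1 - eta) * L)).
have Phi_ge0 eta : 0 < eta <= 1 -> 0 <= Phi eta.
  move=> /andP[eta0 eta1].
  have td : 0 <= (1 - eta) * delta < delta by apply/andP; split; nra.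
  have sd : - delta < (1 - eta) * L <= 0 by apply/andP; split; nra.
  set t := (1 - eta) * delta in td *; set s := (1 - eta) * L in sd *.
  have [/andP[t0 tdel] /andP[sdel s0]] := (td, sd).
  have H1 : m t * cos_weight w c t - m 0 * cos_weight w c 0 <= G 1 t - G 1 0.
    apply: (@weighted_mean_increment m (Num.max 0)) => // x /andP[x0 xt].
      by rewrite mul1r; exact/max_idPr.
    by apply: mslope; rewrite ltr_norml; apply/andP; split; lra.
  have H2 : m 0 * cos_weight w c 0 - m s * cos_weight w c s <= G 0 0 - G 0 s.
    apply: (@weighted_mean_increment m (Num.max 0)) => // x /andP[xs x0].
      by rewrite mul0r; exact/max_idPl.
    by apply: mslope; rewrite ltr_norml; apply/andP; split; lra.
  have mt : `|m t| <= B by apply: mB; rewrite ltr_norml; apply/andP; split; lra.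
  have ms : `|m s| <= B by apply: mB; rewrite ltr_norml; apply/andP; split; lra.
  rewrite /Phi -/t -/s.
  have kt := cos_weight_ge0 w c t; have ks := cos_weight_ge0 w c s.
  have := ler_wpM2r kt mt; have := ler_wpM2r ks ms.
  have := ler_wpM2r kt (ler_norm (- m t)).
  have := ler_wpM2r ks (ler_norm (m s)).
  by rewrite normrN; lra.
have : 0 <= Phi 0.
  apply: ge0_right_limit => //.
  apply: differentiable_continuous; apply/derivable1_diffP.
  rewrite /Phi /G /weighted_bound /cos_weight_primitive /cos_weight.
  exact: ex_derive.
rewrite /Phi subr0 !mul1r.
have wd : w * (delta - c) = pi.
  by rewrite /w /c dW; field; rewrite gt_eqF.
have wL : w * (L - c) = - pi.
  by rewrite /w /L; field; rewrite gt_eqF.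
have w0c : w * (0 - c) = - (pi * y).
  by rewrite /w /c; field; rewrite gt_eqF.
rewrite /G /weighted_bound /cos_weight_primitive /cos_weight.
rewrite wd wL w0c !(cosN, sinN) sinpi cospi.
have -> : (N + (pi * (1 + y) / delta) ^+ 2) / u = (N + w ^+ 2) / u.
  by rewrite (_ : pi * (1 + y) / delta = w)// dW /w; field; rewrite !gt_eqF.
move=> h.
rewrite -(ler_pM2l W0).
have e1 : W * (1 + y + sin (pi * y) / pi) = delta + sin (pi * y) / w.
  rewrite dW /w; move: (sin _) => S; move: (pi : R) pi0 => q q0.
  by field; rewrite !gt_eqF.
have e2 : W * ((N + w ^+ 2) / u + u * r) =
   (N / (2 * u) + u * r / 2) * (2 * W) + w ^+ 2 / (2 * u) * (2 * W).
  by field; rewrite gt_eqF.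
have e3 : delta - L = 2 * W by rewrite dW /L /c; ring.
rewrite e1 e2 -e3.
by lra.
Qed.

End van_trees.

(** The choice [u = D / a] of the multiplier. *)
Lemma sqr_le_of_amgm (R : realFieldType) (a D r : R) :
  0 <= a -> 0 < D -> 0 <= r ->
  (forall u, 0 < u -> 2 * a <= D / u + u * r) -> a ^+ 2 <= D * r.
Proof.
move=> a0 D0 r0 H; have [->|an0] := eqVneq a 0.
  by rewrite expr0n/= mulr_ge0// ltW.
have ap : 0 < a by rewrite lt_neqAle eq_sym an0.
have := H (D / a); rewrite divr_gt0// => /(_ isT).
have -> : D / (D / a) = a by field; rewrite !gt_eqF.
move=> h; rewrite expr2 -ler_pdivlMr// mulrAC.
by lra.
Qed.

(** * Lower bound for the risk *)

Lemma near_norm_lt (R : realType) (delta x : R) :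
  `|x| < delta -> \forall s \near x, `|s| < delta.
Proof.
move=> xd; have e0 : 0 < delta - `|x| by rewrite subr_gt0.
apply/nbhs_ballP; exists (delta - `|x|) => //= s; rewrite /ball/= => sx.
by rewrite -(subrK x s) (le_lt_trans (ler_normD _ _))// distrC -ltrBrDr.
Qed.

Section finite_risk.
Context (R : realType) (d : measure_display) (X : measurableType d).
Variables (nu : {measure set X -> \bar R}).
Variables (delta : R) (P : R -> probability X R).
Variables (p xi : R -> X -> R).
Hypothesis hdelta : 0 < delta.
Hypothesis hp : forall s, `|s| < delta -> is_density nu (p s) (P s).
Hypothesis hxi : forall t, `|t| < delta -> hellinger_derivative nu p t (xi t).
Variables (n : nat) (t : n.-tuple X -> R) (j r : R).
Hypothesis mt : measurable_fun setT t.
Hypothesis xij : forall s, `|s| < delta ->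
  (fisher_information nu (xi s) <= j%:E)%E.
Hypothesis risk : forall s, `|s| < delta ->
  (iid_law (P s) n).-integrable setT (fun y => ((t y - Num.max 0 s) ^+ 2)%:E) /\
  \int[iid_law (P s) n]_y ((t y - Num.max 0 s) ^+ 2) <= r.

Lemma van_trees_risk a : 0 <= a <= 1 ->
  a ^+ 2 <= ((pi * (1 + y_ a) / delta) ^+ 2 + n%:R * j) * r.
Proof.
move=> a01; have /andP[a0 a1] := a01.
have [[y01 yE] _] := y_eqP a01.
have d00 : `|0 : R| < delta by rewrite normr0.
have j0 : 0 <= j.
  rewrite -lee_fin; apply: le_trans (xij d00).
  by rewrite mule_ge0// integral_ge0// => x _; rewrite lee_fin sqr_ge0.
have r0 : 0 <= r.
  by apply: le_trans (risk d00).2; apply: Rintegral_ge0 => x _; exact: sqr_ge0.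
have y10 : 0 < 1 + y_ a by case/andP: y01 => *; rewrite ltr_pwDl.
have D0 : 0 < (pi * (1 + y_ a) / delta) ^+ 2 + n%:R * j.
  by rewrite ltr_pwDl// ?exprn_gt0 ?divr_gt0 ?mulr_gt0 ?pi_gt0// mulr_ge0.
apply: sqr_le_of_amgm => // u u0.
have nearrisk x : `|x| < delta -> \forall s \near x,
  (iid_law (P s) n).-integrable setT (fun y => ((t y - Num.max 0 s) ^+ 2)%:E) /\
  \int[iid_law (P s) n]_y ((t y - Num.max 0 s) ^+ 2) <= r.
  by move=> xd; apply: filterS (near_norm_lt xd) => s; exact: risk.
pose m s := \int[iid_law (P s) n]_y (t y).
have := @van_trees_max _ m delta (y_ a) (n%:R * j) u r (r + 1 + delta)
  hdelta y01 u0.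
rewrite [_ + n%:R * j]addrC => H; apply: le_trans (H _ _) => {H}.
(* the equation of y_ a makes the left-hand side 2 * max(a, 1 - a) >= 2 * a *)
- have -> : 1 + y_ a + sin (pi * y_ a) / pi = 1 + `|2 * a - 1|.
    by rewrite -yE mulNr sinN mulNr opprK addrA.
  by have := ler_norm (2 * a - 1); lra.
- move=> x xd; have := nbhs_singleton (sqr_bias_le mt (nearrisk _ xd)).
  rewrite -/(m x) => b2.
  have b1 : `|m x - Num.max 0 x| <= r + 1.
    move: b2; rewrite -(real_normK (num_real (m x - _))).
    by have := sqr_ge0 (`|m x - Num.max 0 x| - 1 / 2); nra.
  rewrite -(subrK (Num.max 0 x) (m x)); apply: le_trans (ler_normD _ _) _.
  apply: lerD => //; rewrite ger0_norm ?le_max ?lexx// ge_max ltW//=.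
  by rewrite (le_trans (ler_norm x))// ltW.
move=> x xd e e0.
have np : \forall s \near x, is_density nu (p s) (P s).
  by apply: filterS (near_norm_lt xd) => s; exact: hp.
apply: (mean_slope mt np (hxi xd) (xij xd) (nearrisk _ xd)) => //.
by apply: continuous_max; [exact: cvg_cst|exact: cvg_id].
Qed.

End finite_risk.

Unset Implicit Arguments.

Theorem lemma12 (R : realType) (d : measure_display) (X : measurableType d)
    (nu : {sigma_finite_measure set X -> \bar R})
    (delta : R) (hdelta : 0 < delta)
    (P : R -> probability X R) (p : R -> X -> R) (xi : R -> X -> R)
    (hp : forall theta, `|theta| < delta -> is_density nu (p theta) (P theta))
    (hxi : forall t, `|t| < delta -> hellinger_derivative nu p t (xi t))
    (n : nat) :
  (lower_bound delta n
     (ereal_sup [set fisher_information nu (xi t)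
                | t in [set t : R | (`|t| < delta)%R]])
   <= minimax_risk delta P (fun theta : R => Num.max 0 theta)%R n)%E.
Proof.
apply: le_ereal_inf_tmp => _ [t /= mt <-].
pose psi := fun theta : R => Num.max 0 theta; rewrite -/psi.
have d0 : `|0 : R| < delta by rewrite normr0.
have E0 s : (0 <= 'E_(iid_law (P s) n)[fun x => (`|t x - psi s| ^+ 2)%R])%E.
  by apply: expectation_ge0 => x; exact: sqr_ge0.
have M0 : (0 <= max_risk delta P psi t)%E.
  apply: le_trans (E0 0) _; apply: ereal_sup_ubound.
  by exists 0.
have Mr s : `|s| < delta ->
    ('E_(iid_law (P s) n)[fun x => (`|t x - psi s| ^+ 2)%R] <=
     max_risk delta P psi t)%E.
  by move=> sd; apply: ereal_sup_ubound; exists s.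
have Jx s : `|s| < delta -> (fisher_information nu (xi s) <=
    ereal_sup [set fisher_information nu (xi t)
                | t in [set t : R | (`|t| < delta)%R]])%E.
  by move=> sd; apply: ereal_sup_ubound; exists s.
move: Jx; case: ereal_sup => [j||] // Jx.
rewrite /lower_bound; apply: ge_ereal_sup => _ [a /= a01 <-].
move: M0 Mr; case: max_risk => [r||] // r0 Mr; last exact: leey.
have risk s : `|s| < delta ->
    (iid_law (P s) n).-integrable setT (fun y => ((t y - psi s) ^+ 2)%:E) /\
    \int[iid_law (P s) n]_y ((t y - psi s) ^+ 2) <= r.
  move=> /Mr; rewrite unlock.
  under eq_integral do rewrite real_normK ?num_real//.
  move=> h; split.
    apply/integrableP; split.
      by apply/measurable_EFinP; apply: measurable_funX; exact: measurable_funB.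
    under eq_integral do rewrite /= ger0_norm ?sqr_ge0//.
    exact: le_lt_trans h (ltry _).
  rewrite -lee_fin fineK// ge0_fin_numE; first exact: le_lt_trans h (ltry _).
  by apply: integral_ge0 => x _; rewrite lee_fin sqr_ge0.
have a01' : 0 <= a <= 1 by rewrite in_itv in a01.
have := van_trees_risk hdelta hp hxi mt Jx risk a01'.
have -> : (pi * (1 + y_ a) / delta) ^+ 2
    = 4 * pi ^+ 2 * delta ^- 2 * w_ a ^- 2.
  have [[/andP[y0 _] _] _] := y_eqP a01'.
  have y10 : 1 + y_ a != 0 by rewrite gt_eqF// ltr_pwDl.
  have y10' : y_ a + 1 != 0 by rewrite addrC.
  rewrite /w_; move: (pi : R) => q.
  by field; rewrite ?y10' ?gt_eqF.
move=> h; rewrite lee_fin ler_pdivrMr; first by rewrite mulrC.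
have j0 : 0 <= j.
  rewrite -lee_fin; apply: le_trans (Jx _ d0).
  by rewrite mule_ge0// integral_ge0// => x _; rewrite lee_fin sqr_ge0.
rewrite ltr_pwDl ?mulr_ge0//.
have [[/andP[y0 _] _] _] := y_eqP a01'.
by rewrite !(mulr_gt0, invr_gt0, exprn_gt0, pi_gt0, divr_gt0)// ltr_wpDl.
Qed.
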